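(* For every uncountable set $\Gamma$, the Banach space $\ell_1(\Gamma)$ does not contain any overcomplete set.
   Context: A subset $S$ of a Banach space $X$ with $|S| = \operatorname{dens} X$ (density character) is called overcomplete if every subset $\Lambda \subseteq S$ with $|\Lambda| = |S|$ is linearly dense in $X$. *)

(* Defs.v *)
From HB Require Import structures.
From mathcomp Require Import all_boot all_order all_algebra.
From mathcomp Require Import all_classical all_reals.
From mathcomp Require Import ereal esum.
Set Implicit Arguments. Unset Strict Implicit. Unset Printing Implicit Defensive.
Import Order.TTheory GRing.Theory Num.Theory.
Local Open Scope classical_set_scope.
Local Open Scope ring_scope.

Section l1.
Variables (R : realType) (G : choiceType).

Definition l1 : set (G -> R) :=
  [set f | summable [set: G] (fun x => (f x)%:E)].

Definition l1dist (f g : G -> R) : \bar R :=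
  \esum_(x in [set: G]) `|(f x - g x)%:E|%E.

Definition l1_dense (D : set (G -> R)) : Prop :=
  D `<=` l1 /\
  forall f, l1 f -> forall e : R, 0 < e -> exists2 d, D d & (l1dist f d < e%:E)%E.

Definition lspan (L : set (G -> R)) : set (G -> R) :=
  [set f | exists n (v : 'I_n -> G -> R) (c : 'I_n -> R),
      (forall i, L (v i)) /\ f = (fun x => \sum_(i < n) c i * v i x)].

Definition l1_linearly_dense (L : set (G -> R)) : Prop :=
  forall f, l1 f -> forall e : R, 0 < e ->
    exists2 g, lspan L g & (l1dist f g < e%:E)%E.

(* |S| = dens l_1(G): S is equipotent to some dense subset, and injects
   into every dense subset (i.e. |S| is the least cardinality of a dense set). *)
Definition card_is_dens (S : set (G -> R)) : Prop :=
  (exists2 D, l1_dense D & card_eq D S) /\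
  (forall D, l1_dense D -> card_le S D).

Definition l1_overcomplete (S : set (G -> R)) : Prop :=
  [/\ S `<=` l1, card_is_dens S &
      forall L, L `<=` S -> card_eq L S -> l1_linearly_dense L].

End l1.

(* Main.v *)
Require Import Defs.
From HB Require Import structures.
From mathcomp Require Import all_boot all_order all_algebra.
From mathcomp Require Import all_classical all_reals.
From mathcomp Require Import ereal esum.
From mathcomp Require Import numfun lra ring.

Set Implicit Arguments. Unset Strict Implicit. Unset Printing Implicit Defensive.
Import Order.TTheory GRing.Theory Num.Theory.
Local Open Scope classical_set_scope.
Local Open Scope card_scope.

(* Suppose that S is overcomplete. Then S is uncountable, it injects into the set of
   finitely supported rational vectors, and for every functional phi of norm at most 1
   with a coordinate equal to 1, the set of x in S with phi(x) = 0 is smaller than S.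

   S does not inject into a countable union of smaller sets T_n. Otherwise each
   Z_k = {x in S | x_k = 0} injects into some T_n, with the same n for an uncountable set
   of k's, which has a subset K that is uncountable and injects into some T_m. Elements of
   l_1 have countable support, so S is the union of the Z_k for k in K and injects into
   T_m x T_n, hence into T_m or T_n.

   Given F and k outside F, build phi greedily, with phi = 0 on F and phi_k = 1: as long
   as some x in S has more mass off the current domain A than on A \ F, extend phi to the
   support of x so that phi(x) = 0. At the end, A is contained in the union of F, {k} and
   the supports of the x in S killed by phi, and every x in S satisfies
   ||x off A|| <= ||x on A \ F||. Iterating from F_0 = {} gives an increasing sequence
   F_n, and every x in S vanishes off the union of the F_n, because the masses of x on the
   layers F_{n+1} \ F_n tend to 0. If the union is not everything, a coordinate functional
   kills S. If it is, the index set is covered by countably many points and the supports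
   of a subset M of S which is a countable union of smaller sets; then M is uncountable
   and the rational vectors, hence S, inject into M: a contradiction. *)

(** * Cardinal arithmetic *)

Lemma card_le_coverP (T U : Type) (A : set T) (B : set U) :
  A #<= B <->
  exists g : U -> option T, forall a, A a -> exists2 b, B b & g b = Some a.
Proof.
split=> [/ocard_geP /surjPex[g gs]|[g gs]].
  by exists g => a Aa; have [|b Bb <-] := gs (Some a); [exists a | exists b].
by apply/ocard_geP/surjPex; exists g => _ [a Aa <-]; have [b] := gs a Aa; exists b.
Qed.

(** Read from right to left, [r] is a partial map whose values on [B] cover [A]; giving the graph
    avoids building the map. *)
Lemma card_le_rel (T U : Type) (A : set T) (B : set U) (r : T -> U -> Prop) :
  (forall a, A a -> exists2 b, B b & r a b) ->
  (forall a a' b, r a b -> r a' b -> a = a') -> A #<= B.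
Proof.
move=> rA rF; apply/card_le_coverP.
have /choice[g gP] : forall b, exists o : option T,
    (forall a, r a b -> o = Some a).
  move=> b; have [[a rab]|nr] := pselect (exists a, r a b).
    by exists (Some a) => a' ra'b; rewrite (rF _ _ _ rab ra'b).
  by exists None => a rab; case: nr; exists a.
by exists g => a /rA[b Bb rab]; exists b => //; exact: gP.
Qed.

Lemma card_le_ex_inj (T U : Type) (u : U) (A : set T) (B : set U) :
  A #<= B -> exists2 f : T -> U, set_fun A B f & set_inj A f.
Proof.
elim/Ppointed: U => U in B u *; first by case: (no u).
by move/pcard_leP/injfunPex.
Qed.

Lemma card_le_setX (T T' U U' : Type) (A : set T) (A' : set T') (B : set U)
    (B' : set U') : A #<= A' -> B #<= B' -> A `*` B #<= A' `*` B'.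
Proof.
move=> /card_le_coverP[f fP] /card_le_coverP[g gP].
apply: (card_le_rel (r := fun p q => f q.1 = Some p.1 /\ g q.2 = Some p.2)).
  move=> [a b] [/= /fP[a' Aa' fa'] /gP[b' Bb' gb']].
  by exists (a', b').
by move=> [a b] [a' b'] q /= [-> ->] [[->] [->]].
Qed.

Lemma card_le_bigcup (I T U : Type) (J : set I) (F : I -> set T) (B : set U) :
  (forall i, J i -> F i #<= B) -> \bigcup_(i in J) F i #<= J `*` B.
Proof.
move=> FB.
have /choice[g gP] : forall i, exists g : U -> option T,
    J i -> forall a, F i a -> exists2 b, B b & g b = Some a.
  move=> i; have [Ji|] := pselect (J i); last by exists (fun=> None).
  by have /card_le_coverP[g gP] := FB i Ji; exists g.
apply: (card_le_rel (r := fun a q => g q.1 q.2 = Some a)).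
  by move=> a [i Ji Fia]; have [b Bb gb] := gP i Ji a Fia; exists (i, b).
by move=> a a' [i b] /= -> [].
Qed.

(** Zorn yields a maximal graph of a partial bijection between [A] and [B]. It exhausts one side,
    since otherwise one more pair fits. *)
Lemma card_le_total (T U : Type) (A : set T) (B : set U) :
  A #<= B \/ B #<= A.
Proof.
pose P (G : set (T * U)) := [/\ G `<=` A `*` B,
  forall p q, G p -> G q -> p.1 = q.1 -> p = q &
  forall p q, G p -> G q -> p.2 = q.2 -> p = q].
have [|G [[GAB G1 G2] Gmax]] := @Zorn_bigcup _ P.
  move=> F FP Ftot; split=> [p [G FG Gp]||]; first by have [+ _ _] := FP _ FG; apply.
  - move=> p q [G FG Gp] [H FH Hq].
    have [GH|HG] := Ftot _ _ FG FH.
      by have [_ + _] := FP _ FH; apply => //; exact: GH.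
    by have [_ + _] := FP _ FG; apply => //; exact: HG.
  - move=> p q [G FG Gp] [H FH Hq].
    have [GH|HG] := Ftot _ _ FG FH.
      by have [_ _ +] := FP _ FH; apply => //; exact: GH.
    by have [_ _ +] := FP _ FG; apply => //; exact: HG.
have [dA|ndA] := pselect (forall a, A a -> exists b, G (a, b)).
  left; apply: (card_le_rel (r := fun a b => G (a, b))).
    by move=> a /dA[b Gab]; exists b => //; have [] := GAB _ Gab.
  by move=> a a' b Ga Ga'; have [] := G2 _ _ Ga Ga' erefl.
have [dB|ndB] := pselect (forall b, B b -> exists a, G (a, b)).
  right; apply: (card_le_rel (r := fun b a => G (a, b))).
    by move=> b /dB[a Gab]; exists a => //; have [] := GAB _ Gab.
  by move=> b b' a Ga Ga'; have [] := G1 _ _ Ga Ga' erefl.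
have [a [Aa na]] : exists a, A a /\ ~ exists b, G (a, b).
  by apply: contrapT => h; apply: ndA => a Aa; apply: contrapT => na; apply: h; exists a.
have [b [Bb nb]] : exists b, B b /\ ~ exists a, G (a, b).
  by apply: contrapT => h; apply: ndB => b Bb; apply: contrapT => nb; apply: h; exists b.
have := Gmax (G `|` [set (a, b)]); case.
  split; first by move=> p; left.
  by move=> /(_ (a, b) (or_intror erefl)) Gab; apply: na; exists b.
split.
- by move=> p [/GAB//|->].
- move=> [p1 p2] [q1 q2] [Gp|[-> ->]] [Gq|[-> ->]] //=; first exact: (G1 (p1, p2) (q1, q2)).
    by move=> pa; case: na; exists p2; rewrite -pa.
  by move=> pa; case: na; exists q2; rewrite pa.
- move=> [p1 p2] [q1 q2] [Gp|[-> ->]] [Gq|[-> ->]] //=; first exact: (G2 (p1, p2) (q1, q2)).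
    by move=> pa; case: nb; exists p1; rewrite -pa.
  by move=> pa; case: nb; exists q1; rewrite pa.
Qed.

(* [G ((x, y), z)] says that [z] codes the pair
   [(x, y)]; the codes range over the same set as the coordinates. *)
Definition pairing (T : Type) (A : set T) (G : set (T * T * T)) :=
  let X := [set x | exists z, G (x, x, z)] in
  [/\ X `<=` A,
      forall x y z, G (x, y, z) -> [/\ X x, X y & X z],
      forall p q z, G (p, z) -> G (q, z) -> p = q &
      forall x y, X x -> X y -> exists z, G (x, y, z)].

(** Take a maximal pairing, with domain [X]. If the rest of [A] injects into [X], then [A] is no
    larger than [X], which absorbs its square. Otherwise [X] has a copy in the rest, and the pairing
    extends to both, against maximality. *)
Lemma infinite_setXX (T : Type) (A : set T) : infinite_set A -> A `*` A #<= A.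
Proof.
move=> Ainf.
have [t0 At0] : A !=set0 by exact: infinite_setN0.
have /infiniteP/(card_le_ex_inj t0)[h hA hi] := Ainf.
have {}hi i j : h i = h j -> i = j by apply: hi; rewrite inE.
(* A countable pairing to start from; it also puts the tags [h 0], [h 1] and [h 2] into every domain
   met below. *)
pose G0 : set (T * T * T) := [set (h ij.1, h ij.2, h (choice.pickle ij)) | ij in [set: nat * nat]].
have G0P : pairing A G0.
  have X0 i : exists z, G0 (h i, h i, z).
    by exists (h (choice.pickle (i, i))), (i, i).
  have X0P x : (exists z, G0 (x, x, z)) -> exists i, x = h i.
    by move=> [z [[i j] _ [<- _ _]]]; exists i.
  split.
  - by move=> x /X0P[i ->]; exact: hA.
  - by move=> x y z [[i j] _ [<- <- <-]]; split; exact: X0.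
  - move=> p q z [[i j] _ [<- <-]] [[i' j'] _ [<- /hi]].
    by move=> /(pcan_inj choice.pickleK) [-> ->].
  - move=> x y /X0P[i ->] /X0P[j ->].
    by exists (h (choice.pickle (i, j))), (i, j).
(* Adjoining [G0] makes the empty chain harmless. *)
have [|G1 [G1P G1max]] := @Zorn_bigcup _ (fun G => pairing A (G `|` G0)).
  move=> F FP Ftot.
  set X := [set x | exists z, (\bigcup_(Y in F) Y `|` G0) (x, x, z)].
  have FX G x : F G -> (exists z, (G `|` G0) (x, x, z)) -> X x.
    by move=> FG [z [Gz|G0z]]; exists z; [left; exists G | right].
  have G0X x : (exists z, G0 (x, x, z)) -> X x.
    by move=> [z Gz]; exists z; right.
  have [G0A G0c G0f G0d] := G0P.
  split.
  - move=> x [z [[G FG Gx]|G0x]]; last by apply: G0A; exists z.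
    by have [+ _ _ _] := FP _ FG; apply; exists z; left.
  - move=> x y z [[G FG Gx]|/G0c[x0 y0 z0]].
      have [_ + _ _] := FP _ FG; case/(_ x y z (or_introl Gx)).
      by move=> /(FX _ _ FG) Xx /(FX _ _ FG) Xy /(FX _ _ FG) Xz; split.
    by split; exact: G0X.
  - move=> p q z [[G FG Gp]|G0p] [[H FH Hq]|G0q].
    + have [GH|HG] := Ftot _ _ FG FH.
        by have [_ _ + _] := FP _ FH; apply; left; [exact: GH _ Gp | exact: Hq].
      by have [_ _ + _] := FP _ FG; apply; left; [exact: Gp | exact: HG _ Hq].
    + by have [_ _ + _] := FP _ FG; apply; [left; exact: Gp | right].
    + by have [_ _ + _] := FP _ FH; apply; [right; exact: G0p | left].
    + exact: G0f G0p G0q.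
  (* The chain is totally ordered, so two points of the union already lie in the domain of one
     member. *)
  - have cov x y : X x -> X y -> (exists z, G0 (x, x, z) /\ exists z, G0 (y, y, z)) \/
       exists G, F G /\ ((exists z, (G `|` G0) (x, x, z)) /\ exists z, (G `|` G0) (y, y, z)).
      move=> [z [[G FG Gz]|G0z]] [w [[H FH Hw]|G0w]].
      + right; have [GH|HG] := Ftot _ _ FG FH.
          by exists H; split=> //; split; [exists z; left; exact: GH | exists w; left].
        by exists G; split=> //; split; [exists z; left | exists w; left; exact: HG].
      + by right; exists G; split=> //; split; [exists z; left | exists w; right].
      + by right; exists H; split=> //; split; [exists z; right | exists w; left].
      + by left; exists z; split=> //; exists w.
    move=> x y Xx Xy; case: (cov x y Xx Xy) => [[z [G0z G0w]]|[G [FG [Gx Gy]]]].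
      by have [|v Gv] := G0d x y _ G0w; [exists z | exists v; right].
    have [_ _ _ +] := FP _ FG; case/(_ x y Gx Gy) => v [Gv|G0v].
      by exists v; left; exists G.
    by exists v; right.
set G := G1 `|` G0 in G1P.
have Gmax H : G `<=` H -> pairing A H -> H `<=` G.
  move=> GH HP p Hp; apply: contrapT => nGp; apply: (G1max H); last first.
    by rewrite setUidl// => q G0q; apply: GH; right.
  split; first by move=> q G1q; apply: GH; left.
  by move=> /(_ _ Hp) G1p; apply: nGp; left.
have [XA Gc Gf Gd] := G1P; set X := [set x | _] in XA Gc Gd.
have Xh i : X (h i) by exists (h (choice.pickle (i, i))); right; exists (i, i).
have XX : X `*` X #<= X.
  apply: (card_le_rel (r := fun p z => G (p, z))); last exact: Gf.
  by move=> [x y] [/= Xx Xy]; have [z Gz] := Gd x y Xx Xy; exists z => //; have [] := Gc _ _ _ Gz.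
have [AX|XAX] := card_le_total (A `\` X) X.
  have AleX : A #<= X.
    apply: card_le_trans XX.
    have [k kP] := (card_le_coverP _ _).1 AX.
    (* The tags [h 0] and [h 1] mark two disjoint copies of [X], one covering [X] and the other [A]
       minus [X]. *)
    apply: (card_le_rel (r := fun a q => (q.1 = h 0%N /\ a = q.2) \/
       (q.1 = h 1%N /\ k q.2 = Some a))).
      move=> a Aa; have [Xa|nXa] := pselect (X a).
        by exists (h 0%N, a); [split; [exact: Xh|] | left].
      by have [//|b Xb kb] := kP a; exists (h 1%N, b); [split; [exact: Xh|] | right].
    move=> a a' [u v] /= [[-> ->]|[-> ka]] [[]|[]] //.
    - by move=> /hi.
    - by move=> /hi.
    - by move=> _; rewrite ka => -[].
  apply: card_le_trans (card_le_setX AleX AleX) _.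
  by apply: card_le_trans XX _; exact: subset_card_le.
have [f fXA fi] := card_le_ex_inj t0 XAX.
have {}fi x y : X x -> X y -> f x = f y -> x = y.
  by move=> Xx Xy; apply: fi; rewrite inE.
(* [X] copies to [f @` X], outside [X]; a new pair gets the code [f v], where [v]
   codes the shape of the pair ([h 0], [h 1] or [h 2]) and its preimage in [X]. *)
pose H : set (T * T * T) := [set p | exists x y u v, G (x, y, u) /\
   ((p = (x, f y, f v) /\ G (h 0%N, u, v)) \/
   ((p = (f x, y, f v) /\ G (h 1%N, u, v)) \/
    (p = (f x, f y, f v) /\ G (h 2%N, u, v))))].
have nXf x : X x -> ~ X (f x) by move=> /fXA[].
have HP : pairing A (G `|` H).
  set X' := [set x | exists z, (G `|` H) (x, x, z)].
  have XX' x : X x -> X' x by move=> [z Gz]; exists z; left.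
  have fX' x : X x -> X' (f x).
    move=> Xx; have [u Gu] := Gd x x Xx Xx.
    have [_ _ Xu] := Gc _ _ _ Gu; have [v Gv] := Gd (h 2%N) u (Xh _) Xu.
    by exists (f v); right; exists x, x, u, v; split=> //; right; right.
  have Hcases p : H p -> exists x y u v t, [/\ G (x, y, u), G (t, u, v), p.2 = f v
     & ((p.1 = (x, f y) /\ t = h 0%N) \/ (p.1 = (f x, y) /\ t = h 1%N) \/ (p.1 = (f x, f y) /\ t = h 2%N))].
    move=> [x [y [u [v [Gu [[-> Gv]|[[-> Gv]|[-> Gv]]]]]]]]; exists x, y, u, v.
    - by exists (h 0%N); split=> //; left.
    - by exists (h 1%N); split=> //; right; left.
    - by exists (h 2%N); split=> //; right; right.
  have X'P x : X' x -> X x \/ exists2 y, X y & x = f y.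
    move=> [z [Gz|]]; first by left; exists z.
    move=> /Hcases[a [b [u [v [t [/Gc[Xa Xb _] _ _]]]]]] /=.
    by move=> [[[-> _] _]|[[[-> _] _]|[[-> _] _]]]; [left|right; exists a|right; exists a].
  split.
  - by move=> x /X'P[/XA//|[y Xy ->]]; have [] := fXA _ Xy.
  - move=> x y z [/Gc[/XX' ? /XX' ? /XX' ?]//|/Hcases[a [b [u [v [t [Gu Gv /= zv]]]]]]].
    have [Xa Xb Xu] := Gc _ _ _ Gu; have [_ _ Xv] := Gc _ _ _ Gv.
    by rewrite zv => -[[[-> ->] _]|[[[-> ->] _]|[[-> ->] _]]]; split; do ?[exact: fX'|exact: XX'].
  - move=> p q z [Gp|Hp] [Gq|Hq].
    + exact: Gf Gp Gq.
    + move: Gp Hq; case: p => x y /Gc[_ _ Xz] /Hcases[a [b [u [v [t [_ /Gc[_ _ /nXf+] /= zv _]]]]]].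
      by rewrite -zv.
    + move: Gq Hp; case: q => x y /Gc[_ _ Xz] /Hcases[a [b [u [v [t [_ /Gc[_ _ /nXf+] /= zv _]]]]]].
      by rewrite -zv.
    + move: Hp Hq => /Hcases[a [b [u [v [t [Gu Gv /= zv ct]]]]]].
      move=> /Hcases[a' [b' [u' [v' [t' [Gu' Gv' /= zv' ct']]]]]].
      have [_ _ Xv] := Gc _ _ _ Gv; have [_ _ Xv'] := Gc _ _ _ Gv'.
      have vv' : v = v' by apply: fi => //; rewrite -zv.
      rewrite -vv' in Gv'; have [tt' uu'] := Gf _ _ _ Gv Gv'.
      rewrite -uu' in Gu'; have [aa' bb'] := Gf _ _ _ Gu Gu'.
      move: ct ct'; rewrite -tt' -aa' -bb'.
      by move=> [[-> ->]|[[-> ->]|[-> ->]]] [[->]|[[->]|[->]]] // /hi.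
  - move=> x y /X'P[Xx|[a Xa ->]] /X'P[Xy|[b Xb ->]].
    + by have [z Gz] := Gd x y Xx Xy; exists z; left.
    + have [u Gu] := Gd x b Xx Xb; have [_ _ Xu] := Gc _ _ _ Gu.
      have [v Gv] := Gd (h 0%N) u (Xh _) Xu.
      by exists (f v); right; exists x, b, u, v; split=> //; left.
    + have [u Gu] := Gd a y Xa Xy; have [_ _ Xu] := Gc _ _ _ Gu.
      have [v Gv] := Gd (h 1%N) u (Xh _) Xu.
      by exists (f v); right; exists a, y, u, v; split=> //; right; left.
    + have [u Gu] := Gd a b Xa Xb; have [_ _ Xu] := Gc _ _ _ Gu.
      have [v Gv] := Gd (h 2%N) u (Xh _) Xu.
      by exists (f v); right; exists a, b, u, v; split=> //; right; right.
(* Maximality forces [H] into [G], which puts [f (h 0)] into [X], although [f] takes its values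
   outside [X]. *)
have GH := Gmax _ (@subsetUl _ G H) HP.
have [u Gu] := Gd _ _ (Xh 0%N) (Xh 0%N); have [_ _ Xu] := Gc _ _ _ Gu.
have [v Gv] := Gd (h 2%N) u (Xh _) Xu.
have Hv : H (f (h 0%N), f (h 0%N), f v).
  by exists (h 0%N), (h 0%N), u, v; split=> //; right; right.
have /Gc[Xf _ _] := GH _ (or_intror Hv).
by have := nXf _ (Xh 0%N) Xf.
Qed.

Lemma infinite_setX_le (T U V : Type) (A : set T) (B : set U) (C : set V) :
  infinite_set C -> A #<= C -> B #<= C -> A `*` B #<= C.
Proof.
move=> Cinf leAC leBC; apply: card_le_trans (card_le_setX leAC leBC) _.
exact: infinite_setXX.
Qed.

Lemma infinite_bigcup_le (T U : Type) (F : nat -> set T) (C : set U) :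
  infinite_set C -> (forall n, F n #<= C) -> \bigcup_n F n #<= C.
Proof.
move=> Cinf FC; apply: card_le_trans (card_le_bigcup (fun n _ => FC n)) _.
by apply: infinite_setX_le => //; exact/infiniteP.
Qed.

Lemma countableU (T : Type) (A B : set T) :
  countable A -> countable B -> countable (A `|` B).
Proof.
move=> Ac Bc; rewrite -bigcup2inE; apply: bigcup_countable => // -[|[|n]] //=.
Qed.

(** * Sums of elements of l_1 *)

Local Open Scope ring_scope.

Section Sum.
Context (R : realType) (G : choiceType).
Implicit Types (f g x phi : G -> R) (A : set G).

(** [esum] is a supremum of finite subsums, a true sum only for nonnegative terms; hence the two
    parts. *)
Definition lsum f : R :=
  fine (\esum_(i in [set: G]) ((EFin \o f)^\+ i) -
        \esum_(i in [set: G]) ((EFin \o f)^\- i))%E.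

Lemma l1_le f g : (forall i, `|g i| <= `|f i|) -> l1 f -> l1 g.
Proof.
move=> gf; apply: le_lt_trans; apply: le_esum => i _.
by rewrite !abse_EFin lee_fin.
Qed.

Lemma l1_abs f : l1 f -> l1 (fun i => `|f i|).
Proof. by apply: l1_le => i; rewrite normr_id. Qed.

Lemma l1D f g : l1 f -> l1 g -> l1 (fun i => f i + g i).
Proof. exact: summableD. Qed.

Lemma l1N f : l1 f -> l1 (fun i => - f i).
Proof. by apply: l1_le => i; rewrite normrN. Qed.

Lemma l1B f g : l1 f -> l1 g -> l1 (fun i => f i - g i).
Proof. by move=> lf /l1N; exact: l1D. Qed.

Lemma l1_fin f : l1 f -> (forall i, 0 <= f i) ->
  \esum_(i in [set: G]) (f i)%:E \is a fin_num.
Proof.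
move=> lf f0; move: lf; rewrite /l1 /= summableE; congr (_ \is a fin_num).
by apply: eq_esum => i _; rewrite abse_EFin ger0_norm.
Qed.

(** Here [f] and [g] need not be the positive and negative parts of [h]; this freedom is what yields
    additivity. *)
Lemma lsumE f g h : l1 f -> l1 g -> (forall i, 0 <= f i) -> (forall i, 0 <= g i) ->
  (forall i, h i = f i - g i) ->
  lsum h = fine (\esum_(i in [set: G]) (f i)%:E) - fine (\esum_(i in [set: G]) (g i)%:E).
Proof.
move=> lf lg f0 g0 hE; rewrite /lsum.
have -> : (EFin \o h = (EFin \o f) \- (EFin \o g))%E by apply/funext => i /=; rewrite hE EFinB.
rewrite esumB//; [|by move=> i _; rewrite lee_fin..].
by rewrite fineB//; exact: l1_fin.
Qed.

Lemma lsum_ge0E f : l1 f -> (forall i, 0 <= f i) ->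
  (lsum f)%:E = \esum_(i in [set: G]) (f i)%:E.
Proof.
move=> lf f0; rewrite (@lsumE f (fun=> 0)) //.
- by rewrite [X in fine X - _]/= (@esum1 _ _ _ (fun=> 0%:E))//= subr0 fineK// l1_fin.
- by apply: l1_le lf => i; rewrite normr0.
- by move=> i; rewrite subr0.
Qed.

Lemma maxr0_ge0 (r : R) : 0 <= Num.max r 0.
Proof. by rewrite le_max lexx orbT. Qed.

Lemma maxr0B (r : R) : Num.max r 0 - Num.max (- r) 0 = r.
Proof.
by case: (leP r 0) => r0; [rewrite max_l ?oppr_ge0//|rewrite max_r ?oppr_le0 ?ltW//]; ring.
Qed.

Lemma l1_pos f : l1 f -> l1 (fun i => Num.max (f i) 0).
Proof. by apply: l1_le => i; case: (leP (f i)); rewrite ?normr0. Qed.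

Lemma lsumD f g : l1 f -> l1 g -> lsum (fun i => f i + g i) = lsum f + lsum g.
Proof.
move=> lf lg.
have [lfp lgp] := (l1_pos lf, l1_pos lg).
have [lfn lgn] := (l1_pos (l1N lf), l1_pos (l1N lg)).
have m0 := maxr0_ge0.
rewrite (lsumE (h := f) lfp lfn) => // [|i]; last by rewrite maxr0B.
rewrite (lsumE (h := g) lgp lgn) => // [|i]; last by rewrite maxr0B.
rewrite (lsumE (l1D lfp lgp) (l1D lfn lgn)); try by move=> i; rewrite addr_ge0.
  do 2 (rewrite (eq_esum (fun i _ => EFinD _ _)) esumD; [|by move=> i _; rewrite lee_fin..]).
  by rewrite !fineD ?l1_fin//; ring.
by move=> i; rewrite -{1}(maxr0B (f i)) -{1}(maxr0B (g i)); ring.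
Qed.

Lemma l1_0 : l1 (fun _ : G => 0 : R).
Proof. by rewrite /l1 /= /summable esum1// => i _; rewrite abse0. Qed.

Lemma lsum0 : lsum (fun _ : G => 0 : R) = 0.
Proof.
have := lsumD l1_0 l1_0.
by under [X in lsum X]funext do rewrite addr0; lra.
Qed.

Lemma lsumN f : l1 f -> lsum (fun i => - f i) = - lsum f.
Proof.
move=> lf; have := lsumD lf (l1N lf).
by under [X in lsum X]funext do rewrite subrr; rewrite lsum0; lra.
Qed.

Lemma lsumB f g : l1 f -> l1 g -> lsum (fun i => f i - g i) = lsum f - lsum g.
Proof. by move=> lf lg; rewrite lsumD ?lsumN//; exact: l1N. Qed.

Lemma lsum_ge0 f : l1 f -> (forall i, 0 <= f i) -> 0 <= lsum f.
Proof. by move=> lf f0; rewrite -lee_fin lsum_ge0E// esum_ge0// => i _; rewrite lee_fin. Qed.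

Lemma ler_lsum f g : l1 f -> l1 g -> (forall i, f i <= g i) -> lsum f <= lsum g.
Proof.
move=> lf lg fg; rewrite -subr_ge0 -lsumB// lsum_ge0//; first exact: l1B.
by move=> i; rewrite subr_ge0.
Qed.

Lemma ler_norm_lsum f : l1 f -> `|lsum f| <= lsum (fun i => `|f i|).
Proof.
move=> lf; have la := l1_abs lf; rewrite ler_norml -(lsumN la).
have ln := l1N la; apply/andP; split; apply: ler_lsum => // i; last exact: ler_norm.
by rewrite lerNl -normrN ler_norm.
Qed.

Lemma esumZ_le (c : R) f : 0 <= c -> (forall i, 0 <= f i) ->
  (\esum_(i in [set: G]) (c * f i)%:E <= c%:E * \esum_(i in [set: G]) (f i)%:E)%E.
Proof.
move=> c0 f0; apply: ge_ereal_sup => _ [X XI <-].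
rewrite (eq_fsbigr (fun i => c%:E * (f i)%:E))%E => [|i _]; last by rewrite EFinM.
rewrite -ge0_mule_fsumr => [|i]; last by rewrite lee_fin.
by rewrite lee_wpmul2l ?lee_fin//; apply: ereal_sup_ubound; exists X.
Qed.

Lemma l1Z (c : R) f : l1 f -> l1 (fun i => c * f i).
Proof.
move=> lf; have := l1_fin (l1_abs lf) (fun i => normr_ge0 _) => fin.
rewrite /l1 /= /summable.
rewrite (eq_esum (b := fun i => (`|c| * `|f i|)%:E)) => [|i _]; last first.
  by rewrite abse_EFin normrM.
apply: le_lt_trans (esumZ_le _ _) _ => //.
by rewrite -(fineK fin) -EFinM ltry.
Qed.

Lemma lsumZ (c : R) f : l1 f -> lsum (fun i => c * f i) = c * lsum f.
Proof.
have le1 a g : 0 <= a -> (forall i, 0 <= g i) -> l1 g ->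
    lsum (fun i => a * g i) <= a * lsum g.
  move=> a0 g0 lg; rewrite -lee_fin EFinM !lsum_ge0E//; first exact: esumZ_le.
    exact: l1Z.
  by move=> i; rewrite mulr_ge0.
have eq1 a g : 0 <= a -> (forall i, 0 <= g i) -> l1 g ->
    lsum (fun i => a * g i) = a * lsum g.
  move=> a0 g0 lg; have [->|an0] := eqVneq a 0.
    by under [X in lsum X]funext do rewrite mul0r; rewrite lsum0 mul0r.
  have ap : 0 < a by rewrite lt_def an0.
  apply/eqP; rewrite eq_le le1//=.
  have ag0 i : 0 <= a * g i by rewrite mulr_ge0.
  have ai0 : 0 <= a^-1 by rewrite invr_ge0.
  (* The reverse inequality is the one for [a^-1] applied to [a * g]. *)
  have := le1 _ _ ai0 ag0 (l1Z a lg).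
  under [X in lsum X]funext do rewrite mulKf//.
  by rewrite -(ler_pM2l ap) mulVKf.
have eq2 a g : 0 <= a -> l1 g -> lsum (fun i => a * g i) = a * lsum g.
  move=> a0 lg.
  have [lp ln] := (l1_pos lg, l1_pos (l1N lg)).
  have -> : g = fun i => Num.max (g i) 0 - Num.max (- g i) 0 by apply/funext => i; rewrite maxr0B.
  under [X in lsum X]funext do rewrite mulrBr.
  rewrite !lsumB ?eq1//; do ?[exact: l1Z|exact: maxr0_ge0|by move=> i; exact: maxr0_ge0].
  by ring.
move=> lf; have [c0|/ltW c0] := leP 0 c; first exact: eq2.
rewrite -[c]opprK; under [X in lsum X]funext do rewrite mulNr.
by rewrite lsumN ?eq2 ?oppr_ge0//; [ring|exact: l1Z].
Qed.

Definition delta (k : G) : G -> R := fun i => (i == k)%:R.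

Lemma esum_delta k : \esum_(i in [set: G]) (delta k i)%:E = 1%:E.
Proof.
transitivity (\esum_(i in [set k]) (delta k i)%:E).
  rewrite [RHS]esum_mkcond; apply: eq_esum => i _; rewrite /delta.
  by case: eqVneq => [->|/eqP ik]; [rewrite mem_set | rewrite memNset].
by rewrite esum_set1 /delta ?eqxx// lee_fin.
Qed.

Lemma l1_delta k : l1 (delta k).
Proof.
rewrite /l1 /= /summable (eq_esum (b := fun i => (delta k i)%:E)) ?esum_delta ?ltry//.
by move=> i _; rewrite abse_EFin normr_nat.
Qed.

Lemma lsum_delta k f : lsum (fun i => f i * delta k i) = f k.
Proof.
have -> : (fun i => f i * delta k i) = fun i => f k * delta k i.
  by apply/funext => i; rewrite /delta; case: eqVneq => [->//|]; rewrite !mulr0.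
rewrite lsumZ; last exact: l1_delta.
have := @lsum_ge0E (delta k) (l1_delta k) (fun i => ler0n _ _).
by rewrite esum_delta => -[->]; rewrite mulr1.
Qed.

(** * Restriction to a set of coordinates and the norm carried there *)

Definition restr A f : G -> R := fun i => if i \in A then f i else 0.

Lemma l1_restr A f : l1 f -> l1 (restr A f).
Proof. by apply: l1_le => i; rewrite /restr; case: ifP; rewrite ?normr0. Qed.

Definition mass A f : R := lsum (restr A (fun i => `|f i|)).

Lemma l1_restr_abs A f : l1 f -> l1 (restr A (fun i => `|f i|)).
Proof. by move=> lf; exact/l1_restr/l1_abs. Qed.

Lemma restr_abs_ge0 A f i : 0 <= restr A (fun i => `|f i|) i.
Proof. by rewrite /restr; case: ifP. Qed.

Lemma massE A f : l1 f -> (mass A f)%:E = \esum_(i in A) `|f i|%:E.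
Proof.
move=> lf; rewrite /mass lsum_ge0E; [|exact: l1_restr_abs|exact: restr_abs_ge0].
by rewrite [RHS]esum_mkcond; apply: eq_esum => i _; rewrite /restr; case: ifP.
Qed.

Lemma mass_ge0 A f : l1 f -> 0 <= mass A f.
Proof. by move=> lf; apply: lsum_ge0; [exact: l1_restr_abs|exact: restr_abs_ge0]. Qed.

Lemma le_mass A B f : l1 f -> A `<=` B -> mass A f <= mass B f.
Proof.
move=> lf AB; apply: ler_lsum => [||i]; try exact: l1_restr_abs.
rewrite /restr; case: ifPn; last by move=> _; exact: restr_abs_ge0.
by rewrite inE => /AB Bi; rewrite mem_set.
Qed.

Lemma massD A B f : l1 f -> A `<=` B -> mass B f = mass A f + mass (B `\` A) f.
Proof.
move=> lf AB; rewrite /mass -lsumD; try exact: l1_restr_abs.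
congr lsum; apply/funext => i; rewrite /restr in_setD.
have [Ai|] := boolP (i \in A); last by rewrite andbT add0r.
by rewrite andbF addr0 mem_set//; apply: AB; rewrite inE in Ai.
Qed.

Lemma coord_le_mass A f i : l1 f -> A i -> `|f i| <= mass A f.
Proof.
move=> lf Ai; rewrite -[leLHS](lsum_delta i (fun i => `|f i|)).
have ld : l1 (fun j => `|f j| * delta i j).
  apply: l1_le lf => j; rewrite /delta; case: eqVneq => _.
    by rewrite mulr1 normr_id.
  by rewrite mulr0 normr0.
apply: ler_lsum => //; first exact: l1_restr_abs.
move=> j; rewrite /delta; case: eqVneq => [->|_].
  by rewrite mulr1 /restr mem_set.
by rewrite mulr0 restr_abs_ge0.
Qed.

Lemma l1M phi f : (forall i, `|phi i| <= 1) -> l1 f -> l1 (fun i => phi i * f i).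
Proof. by move=> p1; apply: l1_le => i; rewrite normrM ler_piMl. Qed.

Lemma l1distE f g : l1 f -> l1 g -> l1dist f g = (lsum (fun i => `|f i - g i|))%:E.
Proof.
move=> lf lg; rewrite /l1dist; under eq_esum do rewrite abse_EFin.
by rewrite -lsum_ge0E//; exact/l1_abs/l1B.
Qed.

(** The bounded family [phi] acts as a functional of norm at most 1. It vanishes on the span of [L]
    and is 1 at [delta k], so the span stays at distance at least 1 from [delta k]. *)
Lemma kernel_not_linearly_dense phi k (L : set (G -> R)) :
  (forall i, `|phi i| <= 1) -> phi k = 1 -> L `<=` @l1 R G ->
  (forall x, L x -> lsum (fun i => phi i * x i) = 0) -> ~ l1_linearly_dense L.
Proof.
move=> p1 pk Ll1 Lphi /(_ _ (l1_delta k) 1 ltr01)[g Lg dg].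
have [lg pg0] : l1 g /\ lsum (fun i => phi i * g i) = 0.
  case: Lg dg => n [v [c [Lv ->]]] _.
  elim: n v c Lv => [|n IHn] v c Lv.
    split; first by under [X in l1 X]funext do rewrite big_ord0; exact: l1_0.
    by under [X in lsum X]funext do rewrite big_ord0 mulr0; rewrite lsum0.
  pose h (y : G) := \sum_(i < n) c (widen_ord (leqnSn n) i) * v (widen_ord (leqnSn n) i) y.
  have [lh ph] : l1 h /\ lsum (fun i => phi i * h i) = 0 by apply: IHn => i; exact: Lv.
  have lv := Ll1 _ (Lv ord_max).
  have sumE y : \sum_(i < n.+1) c i * v i y = h y + c ord_max * v ord_max y.
    by rewrite big_ord_recr.
  under [X in l1 X]funext do rewrite sumE.
  under [X in lsum X]funext do rewrite sumE mulrDr mulrCA.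
  split; first by apply: l1D => //; exact: l1Z.
  rewrite lsumD; [|exact: l1M|by apply: l1Z; exact: l1M].
  by rewrite ph lsumZ ?Lphi ?mulr0 ?addr0//; exact: l1M.
have ld := l1B (l1_delta k) lg.
move: dg; rewrite l1distE//; last exact: l1_delta.
rewrite lte_fin ltNge => /negP; apply.
have -> : 1 = lsum (fun i => phi i * (delta k i - g i)).
  under [X in lsum X]funext do rewrite mulrBr.
  rewrite lsumB ?lsum_delta ?pg0 ?subr0//; last exact: l1M.
  by apply: l1M => //; exact: l1_delta.
apply: le_trans (ler_norm _) _; apply: le_trans (ler_norm_lsum _) _; first exact: l1M.
apply: ler_lsum => [||i]; [by apply/l1_abs/l1M|exact: l1_abs|].
by rewrite normrM ler_piMl.
Qed.

(** * Finitely supported rational vectors: density and cardinality *)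

Fixpoint ratspan (n : nat) : set (G -> R) :=
  if n is n'.+1 then
    [set (fun i => p.1 i + ratr p.2.2 * delta p.2.1 i) | p in ratspan n' `*` [set: G * rat]]
  else [set fun=> 0].

Lemma l1_ratspan n : ratspan n `<=` @l1 R G.
Proof.
elim: n => [_ ->|n IHn _ [[d [k q]] [/= /IHn ld _] <-]]; first exact: l1_0.
by apply: l1D => //; apply: l1Z; exact: l1_delta.
Qed.

(** Induction on [s]: half of the error goes to the coordinate [k], the other half to the remaining
    ones. *)
Lemma ratspan_approx (s : seq G) f (e : R) : l1 f -> (forall i, i \notin s -> f i = 0) ->
  0 < e -> exists n, exists2 d, ratspan n d & lsum (fun i => `|f i - d i|) < e.
Proof.
elim: s f e => [|k s IHs] f e lf fs e0.
  exists 0%N, (fun=> 0) => //.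
  under [X in lsum X]funext => i do rewrite fs// subrr normr0.
  by rewrite lsum0.
pose f' i := if i == k then 0 else f i.
have lf' : l1 f' by apply: l1_le lf => i; rewrite /f'; case: ifP; rewrite ?normr0.
have e20 : 0 < e / 2 by rewrite divr_gt0.
have [|n [d nd fd]] := IHs f' (e / 2) lf' _ e20.
  by move=> i nis; rewrite /f'; case: eqVneq => // ik; rewrite fs// inE negb_or ik.
have ld := l1_ratspan nd.
have [q] : exists q, ratr q \in `]f k - e / 2, f k + e / 2[.
  by apply: rat_in_itvoo; lra.
rewrite in_itv/= => /andP[q1 q2].
exists n.+1, (fun i => d i + ratr q * delta k i); first by exists (d, (k, q)).
have lfd := l1_abs (l1B lf' ld).
have lk : l1 (fun i => `|f k - ratr q| * delta k i) by apply: l1Z; exact: l1_delta.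
apply: (@le_lt_trans _ _ (lsum (fun i => `|f' i - d i| + `|f k - ratr q| * delta k i))).
  apply: ler_lsum => [||i]; [|exact: l1D|].
    by apply/l1_abs/l1B => //; apply: l1D => //; apply: l1Z; exact: l1_delta.
  (* Nothing makes [d] vanish at [k], so its value there counts as error against [f' k = 0]. *)
  rewrite /f' /delta; case: eqVneq => [->|_].
    by rewrite !mulr1 (_ : f k - _ = (0 - d k) + (f k - ratr q)) ?ler_normD//; ring.
  by rewrite !mulr0 !addr0.
rewrite lsumD// lsumZ; last exact: l1_delta.
have -> : lsum (delta k) = 1.
  by have := lsum_delta k (fun=> 1); under [X in lsum X]funext do rewrite mul1r.
have : `|f k - ratr q| < e / 2 by rewrite ltr_norml; apply/andP; split; lra.
rewrite mulr1; move: fd; lra.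
Qed.

(** All but [e / 2] of the norm of [f] sits on a finite set, and the restriction to that set is
    approximated within [e / 2]. *)
Lemma ratspan_dense : l1_dense (\bigcup_n ratspan n).
Proof.
split; first by move=> d [n _ /l1_ratspan].
move=> f lf e e0; have e20 : 0 < e / 2 by rewrite divr_gt0.
have la := l1_abs lf.
have fin := l1_fin la (fun i => normr_ge0 _).
have [_ [X [Xfin _] <-] Xe] := ub_ereal_sup_adherent e20 fin.
have {}Xe : mass (~` X) f < e / 2.
  move: Xe; rewrite -esum_fset// -massE// -/(esum _ _) -lsum_ge0E//.
  have -> : lsum (fun i => `|f i|) = mass setT f.
    by congr lsum; apply/funext => i; rewrite /restr in_setT.
  by rewrite (@massD X setT)// setTD -EFinB lte_fin; lra.
have /finite_seqP[s Xs] := Xfin.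
have lr := l1_restr X lf.
have [|n [d nd rd]] := @ratspan_approx s (restr X f) (e / 2) lr _ e20.
  by move=> i nis; rewrite /restr Xs; case: ifPn => //; rewrite inE/= (negPf nis).
exists d; first by exists n.
have ld := l1_ratspan nd.
rewrite l1distE// lte_fin; apply: (@le_lt_trans _ _ (mass (~` X) f + lsum (fun i => `|restr X f i - d i|))).
  rewrite -lsumD; [|exact: l1_restr_abs|exact/l1_abs/l1B].
  apply: ler_lsum => [||i]; [exact/l1_abs/l1B|apply: l1D; [exact: l1_restr_abs|exact/l1_abs/l1B]|].
  rewrite /restr in_setC; case: (i \in X) => /=; first by rewrite add0r.
  by rewrite sub0r normrN ler_normB.
by move: Xe rd; lra.
Qed.

(** Each level is an image of the previous one times [G * rat], and an infinite [C] absorbs such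
    products. *)
Lemma ratspan_card_le (U : Type) (C : set U) :
  infinite_set C -> [set: G] #<= C -> \bigcup_n ratspan n #<= C.
Proof.
move=> Cinf GC; apply: infinite_bigcup_le => // n; elim: n => [|n IHn].
  apply: card_le_trans ((infiniteP _).1 Cinf).
  exact/countable1.
apply: card_le_trans (card_image_le _ _) _.
apply: infinite_setX_le => //; rewrite -setXTT.
apply: infinite_setX_le => //; apply: card_le_trans ((infiniteP _).1 Cinf).
exact: countableP.
Qed.

Lemma le_coord_lsum f i : l1 f -> `|f i| <= lsum (fun j => `|f j|).
Proof.
move=> lf; apply: (le_trans (@coord_le_mass setT f i lf I)).
by apply: ler_lsum => [||j]; [exact: l1_restr_abs|exact: l1_abs|rewrite /restr in_setT].
Qed.

Lemma ratspan_finite_support n d : ratspan n d -> finite_set [set i | d i != 0].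
Proof.
elim: n d => [d ->|n IHn _ [[d [k q]] [/= /IHn fd _] <-]].
  by apply: sub_finite_set (finite_set0 G) => i /=; rewrite eqxx.
apply: (@sub_finite_set _ _ ([set i | d i != 0] `|` [set k])).
  move=> i /=; rewrite /delta; case: (eqVneq i k) => [->|_]; first by right.
  by rewrite mulr0 addr0; left.
by rewrite finite_setU.
Qed.

(** [f] is a limit of finitely supported vectors, and it vanishes wherever all of them do. *)
Lemma countable_support f : l1 f -> countable [set i | f i != 0].
Proof.
move=> lf.
have /choice[d dP] : forall n : nat, exists d : G -> R,
    (\bigcup_m ratspan m) d /\ (l1dist f d < n.+1%:R^-1%:E)%E.
  move=> n; have [|d Dd fd] := ratspan_dense.2 f lf n.+1%:R^-1; last by exists d.
  by rewrite invr_gt0 ltr0n.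
apply: (@sub_countable _ _ _ (\bigcup_n [set i | d n i != 0])); last first.
  apply: bigcup_countable => // n _; apply: finite_set_countable.
  by have [[m _ /ratspan_finite_support]] := dP n.
apply: subset_card_le => i /= fi0; apply: contrapT => ni.
have {}fi0 : 0 < `|f i| by rewrite normr_gt0.
(* With this [n], the error bound [1 / n.+1] for [d n] is below [|f i|]. *)
pose n := Num.truncn (`|f i|^-1).
have dn0 : d n i = 0 by apply/eqP; apply: contrapT => /negP dni; apply: ni; exists n.
have [[m _ /l1_ratspan ld]] := dP n; rewrite l1distE// lte_fin ltNge => /negP; apply.
have := le_coord_lsum i (l1B lf ld); rewrite dn0 subr0; apply: le_trans.
by rewrite invf_ple ?posrE//; exact/ltW/truncnS_gt.
Qed.

End Sum.

(** * Functionals killing many elements *)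

Section Greedy.
Context (R : realType) (G : choiceType).
Implicit Types (x phi : G -> R) (A F : set G) (S M : set (G -> R)).

Lemma delta_le1 (k i : G) : `|delta R k i| <= 1.
Proof. by rewrite /delta; case: eqVneq; rewrite ?normr1 ?normr0. Qed.

Definition kills phi x := lsum (fun i => phi i * x i) = 0.

Definition supp x : set G := [set i | x i != 0].

Lemma mass_eq0 A x : (forall i, A i -> x i = 0) -> mass A x = 0.
Proof.
move=> x0; rewrite /mass (_ : restr A _ = fun=> 0) ?lsum0//.
apply/funext => i; rewrite /restr; case: ifPn => //.
by rewrite inE => /x0 ->; rewrite normr0.
Qed.

Lemma kills_delta k x : kills (delta R k) x <-> x k = 0.
Proof.
rewrite /kills -(lsum_delta k x).
by under [X in lsum X]funext do rewrite mulrC.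
Qed.

(* [p.2] is a partially built functional and [p.1] the set where its values are final. *)
Definition greedy_state S F k (p : set G * (G -> R)) :=
  [/\ F `|` [set k] `<=` p.1, (forall i, `|p.2 i| <= 1),
      p.2 k = 1, (forall i, F i -> p.2 i = 0) &
      p.1 `<=` F `|` [set k] `|`
        \bigcup_(x in [set x | [/\ S x, supp x `<=` p.1 & kills p.2 x]]) supp x].

Lemma eq_kills phi phi' x : (forall i, supp x i -> phi' i = phi i) ->
  kills phi x -> kills phi' x.
Proof.
move=> e; rewrite /kills => <-; congr lsum; apply/funext => i.
by have [->|/e ->] := eqVneq (x i) 0; rewrite ?mulr0.
Qed.

(** As [p.2] vanishes on [F], what [x] contributes on [p.1] is smaller than its mass off [p.1], so
    values bounded by 1 there can cancel it. Only [supp x] joins the domain, and the killed [x]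
    accounts for it. *)
Lemma greedy_extension S F k p x : S `<=` @l1 R G -> greedy_state S F k p -> S x ->
  mass (p.1 `\` F) x < mass (~` p.1) x ->
  exists2 q, greedy_state S F k q &
    [/\ p.1 `<=` q.1, (forall i, p.1 i -> q.2 i = p.2 i) & supp x `<=` q.1].
Proof.
case: p => A phi Sl1 [/= FA phi1 phik phiF Asub] Sx.
have lx := Sl1 _ Sx.
set m := mass (~` A) x => mlt.
have m0 : 0 < m by apply: le_lt_trans mlt; exact: mass_ge0.
have lpx := l1M phi1 lx; have lr := l1_restr A lpx.
pose t := lsum (restr A (fun i => phi i * x i)).
have tm : `|t| <= m.
  apply: ltW; apply: le_lt_trans mlt; apply: le_trans (ler_norm_lsum lr) _.
  apply: ler_lsum => [||i]; [exact: l1_abs|exact: l1_restr_abs|].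
  rewrite /restr in_setD; case: (i \in A) => /=; last by rewrite normr0.
  case: ifPn => [_|]; first by rewrite normrM ler_piMl.
  by rewrite negbK inE => /phiF ->; rewrite mul0r normr0.
(* The free values off [A] can cancel [t], since [x] has mass [m >= |t|] there. *)
pose c := - t / m.
have c1 : `|c| <= 1.
  by rewrite /c normrM normrN normfV (gtr0_norm m0) ler_pdivrMr// mul1r.
(* The sign turns the part of the pairing off [A] into [c] times a mass, and it gives 0 outside
   [supp x]. *)
pose phi' i := if i \in A then phi i else c * Num.sg (x i).
have phi'A i : A i -> phi' i = phi i by move=> Ai; rewrite /phi' mem_set.
have kx : kills phi' x.
  rewrite /kills.
  have -> : (fun i => phi' i * x i) =
      fun i => restr A (fun i => phi i * x i) i + c * restr (~` A) (fun i => `|x i|) i.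
    apply/funext => i; rewrite /phi' /restr in_setC; case: (i \in A) => /=.
      by rewrite mulr0 addr0.
    by rewrite add0r -mulrA -normrEsg.
  have lc := l1_restr_abs (~` A) lx.
  rewrite lsumD//; last exact: l1Z.
  by rewrite lsumZ// -/t -/(mass _ _) -/m /c mulfVK ?addrN// gt_eqF.
exists (A `|` supp x, phi'); last first.
  by split => /= i; [left|exact: phi'A|right].
split => /=.
- by move=> i /FA; left.
- move=> i; rewrite /phi'; case: ifP => // _.
  by rewrite normrM normr_sg; case: (x i != 0); rewrite ?mulr1 ?mulr0.
- by rewrite phi'A//; apply: FA; right.
- by move=> i Fi; rewrite phi'A ?phiF//; apply: FA; left.
- move=> i [/Asub[FKi|[y [Sy yA ky] yi]]|xi]; [by left|right; exists y|right; exists x] => //.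
  split => //; first by move=> j /yA; left.
  by apply: eq_kills ky => j /yA/phi'A.
Qed.

(** Zorn on states ordered by extension: an [x] violating the bound at a maximal state would allow
    one more greedy step. *)
Lemma greedy_kernel S F k : S `<=` @l1 R G -> ~ F k ->
  exists p, greedy_state S F k p /\
    forall x, S x -> mass (~` p.1) x <= mass (p.1 `\` F) x.
Proof.
move=> Sl1 nFk.
pose T := {p | greedy_state S F k p}.
have t0P : greedy_state S F k (F `|` [set k], delta R k).
  split => /= [//|i||i Fi|i]; [exact: delta_le1|by rewrite /delta eqxx| |by left].
  by rewrite /delta; case: eqVneq => // ik; rewrite ik in Fi.
pose t0 : T := exist _ _ t0P.
(* Values off the domain are not compared, so this is only a preorder. *)
pose le (s t : T) := `[< (sval s).1 `<=` (sval t).1 /\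
  forall i, (sval s).1 i -> (sval t).2 i = (sval s).2 i >].
have [| | |[p pP] pmax] := @ZL_preorder T t0 le.
- by move=> t; apply/asboolP; split.
- move=> r s t /asboolP[rs rsE] /asboolP[st stE]; apply/asboolP; split.
    exact: subset_trans st.
  by move=> i ri; rewrite stE ?rsE//; exact: rs.
- move=> C Ctot.
  have [[s0 Cs0]|C0] := pselect (exists s, C s); last first.
    by exists t0 => s Cs; case: C0; exists s.
  (* The common value along the chain; the default 0 off all domains keeps the bound by 1. *)
  have /choice[psi psiP] : forall i, exists r : R,
      (forall s, C s -> (sval s).1 i -> r = (sval s).2 i) /\
      ((forall s, C s -> ~ (sval s).1 i) -> r = 0).
    move=> i; have [[s [Cs si]]|ns] := pselect (exists s, C s /\ (sval s).1 i).
      exists ((sval s).2 i); split=> [t Ct ti|/(_ _ Cs)//].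
      by have [/asboolP[_ ->//]|/asboolP[_ ->//]] := Ctot _ _ Cs Ct.
    exists 0; split=> // s Cs si; case: ns; by exists s.
  have psiE s i : C s -> (sval s).1 i -> psi i = (sval s).2 i.
    by have [+ _] := psiP i; apply.
  pose A := \bigcup_(s in C) (sval s).1.
  have sA s : C s -> (sval s).1 `<=` A by move=> Cs i si; exists s.
  have uP : greedy_state S F k (A, psi).
    have [FA0 _ k0 F0 _] := svalP s0.
    split => /=.
    + by move=> i /FA0/(sA _ Cs0).
    + move=> i; have [[s Cs si]|nAi] := pselect (A i).
        by rewrite (psiE s)//; have [_ + _ _ _] := svalP s.
      by rewrite (psiP i).2 ?normr0// => s Cs si; apply: nAi; exists s.
    + by rewrite (psiE s0)//; apply: FA0; right.
    + by move=> i Fi; rewrite (psiE s0) ?F0//; apply: FA0; left.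
    + move=> i [s Cs si]; have [_ _ _ _ /(_ _ si)] := svalP s.
      move=> [FKi|[y [Sy ys ky] yi]]; [by left|right; exists y] => //.
      split => //; first exact: subset_trans (sA _ Cs).
      by apply: eq_kills ky => j /ys/(psiE _ _ Cs).
  exists (exist _ _ uP) => s Cs; apply/asboolP; split; first exact: sA.
  by move=> i; exact: psiE.
exists p; split=> // x Sx; rewrite leNgt; apply/negP => lt.
have [q qP [pq pqE xq]] := greedy_extension Sl1 pP Sx lt.
(* By maximality [supp x] already lies in [p.1], so [x] has no mass off it, against the strict
   inequality. *)
have /asboolP[/= qp _] : le (exist _ q qP) (exist _ p pP).
  by apply: pmax; apply/asboolP.
move: lt; rewrite ltNge (@mass_eq0 (~` p.1)) ?mass_ge0//; first exact: Sl1.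
by move=> i pi; apply/eqP; apply: contrapT => /negP /xq/qp.
Qed.

(* The masses of the disjoint layers [F n.+1 `\` F n] are summable, yet each of them
   dominates [`|x k|]. *)
Lemma vanish_outside (F : nat -> set G) x k : l1 x -> (forall n, F n `<=` F n.+1) ->
  (forall n, mass (~` F n.+1) x <= mass (F n.+1 `\` F n) x) ->
  (forall n, ~ F n k) -> x k = 0.
Proof.
move=> lx Finc Fm nFk; apply/eqP; rewrite -normr_eq0; apply/negPn/negP => xk0.
have {}xk0 : 0 < `|x k| by rewrite lt_def xk0 normr_ge0.
have kF n : n%:R * `|x k| <= mass (F n) x.
  elim: n => [|n IHn]; first by rewrite mul0r mass_ge0.
  rewrite (massD lx (Finc n)) -natr1 mulrDl mul1r lerD//.
  exact: le_trans (coord_le_mass lx (nFk n.+1)) (Fm n).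
(* Large enough for [n] times [|x k|] to exceed the whole norm of [x]. *)
pose n := (Num.truncn (mass setT x / `|x k|)).+1.
have := le_trans (kF n) (le_mass lx (@subsetT _ (F n))).
by rewrite -ler_pdivlMr// leNgt truncnS_gt.
Qed.

(** * Sets larger than each of their kernels *)

Section NoSmallKernel.
Context (S : set (G -> R)) (Gunc : ~ countable [set: G]) (Sl1 : S `<=` @l1 R G)
  (kernel_small : forall phi k, (forall i, `|phi i| <= 1) -> phi k = 1 ->
     ~ (S #<= [set x | S x /\ kills phi x])).

Lemma delta_kernel_small k : ~ (S #<= [set x | S x /\ x k = 0]).
Proof.
move=> Sle; apply: (@kernel_small (delta R k) k); first exact: delta_le1.
  by rewrite /delta eqxx.
apply: card_le_trans Sle _; apply: subset_card_le => x [Sx xk].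
by split => //; apply/kills_delta.
Qed.

Lemma nonzero_coord k : exists2 x, S x & x k != 0.
Proof.
apply: contrapT => nS; apply: (@delta_kernel_small k).
apply: subset_card_le => x Sx; split => //.
by apply/eqP; apply: contrapT => /negP xk; apply: nS; exists x.
Qed.

(** The supports of the elements of [S] are countable and cover [G]. *)
Lemma not_countable_S : ~ countable S.
Proof.
move=> Sc; apply: Gunc.
apply: (@sub_countable _ _ _ (\bigcup_(x in S) supp x)); last first.
  by apply: bigcup_countable => // x /Sl1; exact: countable_support.
by apply: subset_card_le => k _; have [x Sx xk] := nonzero_coord k; exists x.
Qed.

(** This is uncountable cofinality. Uncountably many coordinates [k] share one [n] with [Z k]
    injecting into [T n]; every [x] in [S] vanishes at one of them, which bounds [S] by a product of
    two small sets. *)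
Lemma not_small_bigcup (T : nat -> set (G -> R)) :
  (forall n, ~ (S #<= T n)) -> ~ (S #<= \bigcup_n T n).
Proof.
move=> Tsmall ST.
have [m Tm] : exists m, ~ countable (T m).
  apply: contrapT => nT; apply: not_countable_S; apply: sub_countable ST _.
  apply: bigcup_countable => // n _; apply: contrapT => Tn.
  by apply: nT; exists n.
pose Z k := [set x | S x /\ x k = 0].
have /choice[f fP] : forall k, exists n, Z k #<= T n.
  move=> k; apply: contrapT => nZ; apply: (@delta_kernel_small k).
  (* By comparability every [T n] injects into [Z k], and the infinite [Z k] then absorbs their
     union and [S]. *)
  have TZ n : T n #<= Z k.
    by have [|//] := card_le_total (Z k) (T n); move=> ZT; case: nZ; exists n.
  apply: card_le_trans ST _; apply: infinite_bigcup_le => //.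
  by move=> /finite_set_countable; apply: contra_not Tm; apply: sub_countable.
have [n fn] : exists n, ~ countable (f @^-1` [set n]).
  apply: contrapT => nf; apply: Gunc.
  apply: (@sub_countable _ _ _ (\bigcup_n (f @^-1` [set n]))).
    by apply: subset_card_le => k _; exists (f k).
  apply: bigcup_countable => // n _; apply: contrapT => fn.
  by apply: nf; exists n.
(* A fiber larger than [T m] is cut down to a subset equipotent to [T m], still uncountable. *)
have [K [KT Kf Kunc]] : exists K : set G, [/\ K #<= T m, K `<=` f @^-1` [set n] & ~ countable K].
  have [fT|/card_subP[K KT Kf]] := card_le_total (f @^-1` [set n]) (T m).
    by exists (f @^-1` [set n]); split.
  exists K; split => //; first by have /card_eqPle[] := KT.
  by rewrite (eq_countable KT).
have SK : S #<= K `*` T n.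
  apply: card_le_trans (card_le_bigcup (F := Z) (B := T n) _); last first.
    by move=> k /Kf <-.
  (* If [x] vanished nowhere on [K], its countable support would contain [K]. *)
  apply: subset_card_le => x Sx; apply: contrapT => nx; apply: Kunc.
  apply: sub_countable (countable_support (Sl1 Sx)); apply: subset_card_le => k Kk.
  by apply/negP => /eqP xk; apply: nx; exists k.
have Tinf : infinite_set (T m) by move=> /finite_set_countable.
have [TT|TT] := card_le_total (T m) (T n).
  apply: (Tsmall n); apply: card_le_trans SK _; apply: infinite_setX_le => //.
    by move=> /finite_set_countable; apply: contra_not Tm; apply: sub_countable.
  exact: card_le_trans TT.
by apply: (Tsmall m); apply: card_le_trans SK _; exact: infinite_setX_le.
Qed.

(** A coordinate never reached by the iterated greedy construction would vanish on all of [S]. If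
    all are reached, the killed sets [M n] are smaller than [S], yet [S] injects into their
    union. *)
Lemma not_card_le_ratspan : ~ (S #<= \bigcup_n @ratspan R G n).
Proof.
move=> Sdens.
have [k0 _] : exists k : G, True.
  apply: contrapT => nG; apply: Gunc; apply: (@sub_countable _ _ _ (@set0 G)) => //.
  by apply: subset_card_le => k _; apply: nG; exists k.
(* [pk.1] is the next domain, [pk.2.1] a set of killed elements and [pk.2.2] the newly adjoined
   coordinate. *)
have /choice[next nextP] : forall F : set G, exists pk : set G * (set (G -> R) * G),
    [/\ ~ (S #<= pk.2.1), F `<=` pk.1, pk.2.1 `<=` S,
       pk.1 `<=` F `|` [set pk.2.2] `|` \bigcup_(x in pk.2.1) supp x &
      forall x, S x -> mass (~` pk.1) x <= mass (pk.1 `\` F) x].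
  move=> F; have [[k nFk]|FT] := pselect (exists k, ~ F k).
    have [[A phi] [[/= FA p1 pk _ Asub] Am]] := greedy_kernel Sl1 nFk.
    exists (A, ([set x | S x /\ kills phi x], k)); split => //=.
    - exact: kernel_small p1 pk.
    - by move=> i Fi; apply: FA; left.
    - by move=> x [].
    - by move=> i /Asub[|[x [Sx _ kx] xi]]; [left|right; exists x].
  have {}FT i : F i by apply: contrapT => nFi; apply: FT; exists i.
  (* Once [F] is everything, any small subset of [S] will do; the kernel of a coordinate is one. *)
  exists (F, ([set x | S x /\ x k0 = 0], k0)); split => //=.
  - exact: delta_kernel_small.
  - by move=> x [].
  - by move=> i Fi; left; left.
  - by move=> x /Sl1 lx; rewrite (@mass_eq0 (~` F)) ?mass_ge0// => i /(_ (FT i)).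
pose F n := iter n (fun F => (next F).1) set0.
pose M n := (next (F n)).2.1; pose k n := (next (F n)).2.2.
have [[j nFj]|FT] := pselect (exists j, forall n, ~ F n j).
  apply: (@delta_kernel_small j); apply: subset_card_le => x Sx; split => //.
  apply: (vanish_outside (F := F)) => //; first exact: Sl1.
    by move=> n; have [] := nextP (F n).
  by move=> n; have [_ _ _ _] := nextP (F n); apply.
apply: (@not_small_bigcup M); first by move=> n; have [] := nextP (F n).
apply: card_le_trans Sdens _.
have MS : \bigcup_n M n `<=` S by move=> x [n _]; have [_ _ + _ _] := nextP (F n); apply.
have GM j : range k j \/ (\bigcup_(x in \bigcup_n M n) supp x) j.
  have [n] : exists n, F n j.
    by apply: contrapT => nF; apply: FT; exists j => n Fn; apply: nF; exists n.
  elim: n => // n IHn Fj; have [_ _ _ /(_ _ Fj) + _] := nextP (F n).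
  move=> [[//|->]|[x Mx xj]]; first by left; exists n.
  by right; exists x => //; exists n.
have Munc : ~ countable (\bigcup_n M n).
  move=> Mc; apply: Gunc.
  apply: (@sub_countable _ _ _ (range k `|` \bigcup_(x in \bigcup_n M n) supp x)).
    by apply: subset_card_le => j _; exact: GM.
  apply: countableU; first exact: card_image_le.
  by apply: bigcup_countable => // x /MS/Sl1; exact: countable_support.
have Minf : infinite_set (\bigcup_n M n) by move=> /finite_set_countable.
have [x0 Mx0] := infinite_setN0 Minf.
apply: ratspan_card_le => //.
(* Attaching [range k] to every support makes the cover of [G] a single union of countable sets
   indexed by the killed elements. *)
pose B x := range k `|` supp x.
apply: (@card_le_trans _ _ _ (\bigcup_(x in \bigcup_n M n) B x)).
  apply: subset_card_le => j _; have [kj|[x Mx xj]] := GM j; first by exists x0 => //; left.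
  by exists x => //; right.
apply: card_le_trans (card_le_bigcup (B := [set: nat]) _) _; last first.
  by apply: infinite_setX_le => //; exact/infiniteP.
move=> x /MS/Sl1 lx.
by apply: countableU; [exact: card_image_le | exact: countable_support].
Qed.

End NoSmallKernel.

End Greedy.

Theorem theorem3p12 (R : realType) (G : choiceType) :
  ~ countable [set: G] ->
  ~ exists S : set (G -> R), l1_overcomplete S.
Proof.
move=> Gunc [S [Sl1 [_ Smin] Sover]].
(* Minimality of the density injects [S] into the rational vectors. A kernel as large as [S] would
   be linearly dense by overcompleteness, which no kernel is. *)
apply: (not_card_le_ratspan Gunc Sl1) (Smin _ (@ratspan_dense R G)) => phi k p1 pk Sle.
set L := [set x | _] in Sle.
have LS : L `<=` S by move=> x [].
apply: (kernel_not_linearly_dense p1 pk (subset_trans LS Sl1) _ (Sover L LS _)).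
  by move=> x [].
by apply/card_eqPle; split => //; exact: subset_card_le.
Qed.
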